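(* Let $\mathbb{F}$ be either the field of real numbers or a finite field in which $-3$ is a quadratic non-residue. For every $n>5$, the $n\times n$ permanent polynomial $Perm_n(x_{11},\ldots,x_{nn})=\sum_{\sigma\in S_n}\prod_{i=1}^n x_{i,\sigma(i)}$ is not expressible as a read-once determinant over $\mathbb{F}$; that is, there is no matrix $M$ (of any size) whose entries lie in $\{x_{ij}:1\le i,j\le n\}\cup\mathbb{F}$, in which each variable $x_{ij}$ occurs in at most one position, such that $\det(M)=Perm_n$.
   Context: $S_n$ denotes the symmetric group on $\{1,\ldots,n\}$. *)

(* Defs.v *)
From mathcomp Require Import all_boot all_order all_fingroup all_algebra.
From mathcomp Require Import reals.
From mathcomp Require Import mpoly.

Set Implicit Arguments.
Unset Strict Implicit.
Unset Printing Implicit Defensive.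

Import GRing.Theory.
Local Open Scope ring_scope.

(* The n ^ 2 variables x_ij are numbered through the library's bijection
   mxvec_index between pairs of indices and 'I_(n * n). *)
Definition pvar (F : fieldType) (n : nat) (i j : 'I_n) : {mpoly F[n * n]} :=
  'X_(mxvec_index i j).

Definition permanent (F : fieldType) (n : nat) : {mpoly F[n * n]} :=
  \sum_(s : 'S_n) \prod_(i < n) pvar F i (s i).

Definition read_once (F : fieldType) (n m : nat)
    (M : 'M[{mpoly F[n * n]}]_m) : Prop :=
  (forall a b : 'I_m,
      (exists i j : 'I_n, M a b = pvar F i j) \/ (exists c : F, M a b = c%:MP))
  /\ (forall (i j : 'I_n) (a b a' b' : 'I_m),
      M a b = pvar F i j -> M a' b' = pvar F i j -> a = a' /\ b = b').

Definition read_once_det (F : fieldType) (n : nat) (p : {mpoly F[n * n]}) :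
    Prop :=
  exists (m : nat) (M : 'M[{mpoly F[n * n]}]_m), read_once M /\ \det M = p.

(* No hypothesis a != 0 is needed, since 0 is a square. *)
Definition quadratic_nonresidue (F : fieldType) (a : F) : Prop :=
  ~ exists x : F, x ^+ 2 = a.

(* Main.v *)
(* Substituting into Perm_n the block matrix [[diag(s, t, x, 1), J], [J^T, 0]],
   with J the all-ones 4 x 2 matrix, bordered by an identity of size n - 6,
   gives 4 S(s, t, x, 1), where S is the elementary symmetric polynomial of
   degree 2 in 4 variables.  If S came from a read-once determinant, s and t would occur
   at single positions (r1, c1) and (r2, c2), and the Desnanot-Jacobi identity
   would write 16 (x^2 + x + 1) as the product of the cofactors at (r1, c2) and
   (r2, c1).  As x also occurs only once, each cofactor has degree at most 1 in
   x, so x^2 + x + 1 splits and its discriminant -3 is a square. *)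

Require Import Defs.
From HB Require Import structures.
From mathcomp Require Import all_boot all_order all_fingroup all_algebra.
From mathcomp Require Import reals.
From mathcomp Require Import mpoly.
From mathcomp Require Import ring.

Set Implicit Arguments.
Unset Strict Implicit.
Unset Printing Implicit Defensive.
Import GRing.Theory Num.Theory.
Local Open Scope ring_scope.

(** * Permanents of matrices indexed by natural numbers *)

Section NatPermanent.
Variable R : comNzRingType.
Implicit Type A : nat -> nat -> R.

(** Indexing by [nat] lets minors and padding be index shifts, with no casts between ordinal
    types. *)
Definition perm_sum n A : R := \sum_(s : 'S_n) \prod_(i < n) A i (s i).

Lemma eq_perm_sum n A B : A =2 B -> perm_sum n A = perm_sum n B.
Proof. by move=> eqAB; apply: eq_bigr => s _; apply: eq_bigr => i _. Qed.

Lemma perm_sum0 A : perm_sum 0 A = 1.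
Proof.
rewrite /perm_sum (big_pred1 1%g) ?big_ord0 // => s.
by apply/esym/eqP/permP => -[].
Qed.

(** Laplace expansion along row 0: permutations are grouped by the image [j] of 0, and
    [lift_perm ord0 j] parametrizes each group by ['S_n]. *)
Lemma perm_sum_recl n A :
  perm_sum n.+1 A =
    \sum_(j < n.+1) A 0%N j * perm_sum n (fun i k => A i.+1 (bump j k)).
Proof.
rewrite /perm_sum (partition_big (fun s : 'S_n.+1 => s ord0) predT) //=.
apply: eq_bigr => j _; rewrite big_distrr /= (reindex (lift_perm ord0 j)).
  apply: eq_big => [s|s _]; first by rewrite lift_perm_id eqxx.
  rewrite big_ord_recl lift_perm_id; congr (_ * _).
  by apply: eq_bigr => i _; rewrite lift_perm_lift.
(* [ulsf i s] is what remains of [s] once [i] and [s i] are removed. The default [k] is never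
   reached, as [s (lift i k)] differs from [s i]. *)
pose ulsf i (s : 'S_n.+1) k := odflt k (unlift (s i) (s (lift i k))).
have ulsfK i (s : 'S_n.+1) k : lift (s i) (ulsf i s k) = s (lift i k).
  have := neq_lift i k; rewrite /ulsf -(can_eq (permK s)).
  by move=> /unlift_some[? ? ->].
have inj_ulsf s : injective (ulsf ord0 s).
  apply: can_inj (ulsf (s ord0) s^-1%g) _ => k.
  by rewrite {1}/ulsf ulsfK !permK liftK.
exists (fun s => perm (inj_ulsf s)) => [s _|s].
  by apply/permP=> k; rewrite permE /ulsf lift_perm_lift lift_perm_id liftK.
move=> /eqP s0; apply/permP => k; case: (unliftP ord0 k) => [k'|] ->.
  by rewrite lift_perm_lift -s0 permE ulsfK.
by rewrite lift_perm_id.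
Qed.

Definition pad k A i j : R :=
  if (i < k)%N || (j < k)%N then (i == j)%:R else A (i - k)%N (j - k)%N.

Lemma perm_sum_pad k n A : perm_sum (k + n) (pad k A) = perm_sum n A.
Proof.
elim: k => [|k IHk]; first by apply: eq_perm_sum => i j; rewrite /pad !subn0.
rewrite addSn perm_sum_recl big_ord_recl big1 ?addr0 => [|j _].
  by rewrite mul1r -IHk; apply: eq_perm_sum => i j.
by rewrite /pad mul0r.
Qed.

(* [bump], in a form that [cbn] reduces. *)
Fixpoint skip j k : nat :=
  match j, k with
  | 0%N, _ => k.+1
  | _, 0%N => 0
  | j'.+1, k'.+1 => (skip j' k').+1
  end.

Lemma skipE j k : skip j k = bump j k.
Proof. by elim: j k => [|j IHj] [|k] //=; rewrite IHj bumpS. Qed.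

(* Absent entries are [None] rather than [0], so that [cbn] prunes them. *)
Fixpoint laplace n (B : nat -> nat -> option R) : R :=
  if n is n'.+1 then
    foldr (fun j r => if B 0%N j is Some a then
      a * laplace n' (fun i k => B i.+1 (skip j k)) + r else r) 0 (iota 0 n)
  else 1.

Lemma perm_sum_laplace n B :
  perm_sum n (fun i j => odflt 0 (B i j)) = laplace n B.
Proof.
elim: n B => [|n IHn] B; first exact: perm_sum0.
rewrite perm_sum_recl -(big_mkord xpredT (fun j => odflt 0 (B 0%N j) *
  perm_sum n (fun i k => odflt 0 (B i.+1 (bump j k))))).
rewrite unlock /index_iota subn0; cbn [laplace].
elim: (iota 0 n.+1) => //= j r ->; case: (B 0%N j) => [a|] /=.
  rewrite -IHn; congr (_ * _ + _).
  by apply: eq_perm_sum => i k; rewrite skipE.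
by rewrite mul0r add0r.
Qed.

Definition bordered_diag (s t x : R) (i j : nat) : option R :=
  match i, j with
  | 0, 0 => Some s
  | 1, 1 => Some t
  | 2, 2 => Some x
  | 3, 3 => Some 1%R
  | (0 | 1 | 2 | 3), (4 | 5) | (4 | 5), (0 | 1 | 2 | 3) => Some 1%R
  | _, _ => None
  end%N.

(** A nonzero term matches the last two columns with two of the first four rows, and the last two
    rows with the same two indices as columns. The other two indices contribute their diagonal
    entries, and the matchings number 2! * 2! = 4. *)
Lemma laplace_bordered_diag s t x :
  laplace 6 (bordered_diag s t x) = 4%:R * (s * t + (s + t) * (x + 1) + x).
Proof. cbn; ring. Qed.

End NatPermanent.

(** * Determinants: rank-two perturbations and degree bounds *)

(** A bordered matrix has its determinant computed by eliminating either diagonal block. The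
    adjugate replaces the inverse of [N], which need not exist over a domain. *)
Lemma det_add_rank2 (R : idomainType) m (N : 'M[R]_m)
    (U : 'M_(m, 2)) (V : 'M_(2, m)) :
  \det N != 0 ->
  \det N * \det (N + U *m V) = \det ((\det N)%:M + V *m \adj N *m U).
Proof.
move=> d0; set d := \det N.
have dB : \det (block_mx N (- U) V 1%:M) = \det (N + U *m V).
  have -> : block_mx N (- U) V 1%:M =
      block_mx (N + U *m V) (- U) 0 1%:M *m block_mx 1%:M 0 V 1%:M.
    rewrite mulmx_block !(mulmx1, mulmx0, mul0mx, mul1mx, add0r, addr0).
    by rewrite mulNmx addrK.
  by rewrite det_mulmx det_ublock det_lblock !det1 !mulr1.
have E : block_mx N (- U) V 1%:M *m block_mx (\adj N) (\adj N *m U) 0 d%:M =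
  block_mx d%:M 0 (V *m \adj N) (d%:M + V *m \adj N *m U).
  rewrite mulmx_block !(mulmx1, mulmx0, mul0mx, mul1mx, add0r, addr0).
  rewrite !mulmxA mul_mx_adj mulNmx -scalar_mxC addrN.
  by rewrite [X in block_mx _ _ _ X]addrC.
(* The extra factor [d] makes [\det (\adj N)] occur only through [d * \det (\adj N) = d ^+ m]. *)
have /(congr1 (fun z => d * z)) := congr1 determinant E.
rewrite det_mulmx det_ublock det_lblock !det_scalar dB => E'.
have dm : d * \det (\adj N) = d ^+ m.
  by rewrite -det_mulmx mul_mx_adj det_scalar.
have dm0 : d * d ^+ m != 0 by rewrite mulf_neq0 ?expf_neq0.
apply: (mulfI dm0); rewrite -[RHS]mulrA -E' -dm; ring.
Qed.

Lemma det_mx2 (R : comPzRingType) (A : 'M[R]_2) :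
  \det A = A 0 0 * A 1 1 - A 0 1 * A 1 0.
Proof.
have -> : 1 = lift 0 0 :> 'I_2 by apply: val_inj.
rewrite (expand_det_row _ 0) !big_ord_recl big_ord0 addr0 /cofactor !det_mx11.
rewrite !mxE /= expr0 mul1r expr1 mulN1r mulrN.
by congr (_ * A _ _ - _ * A _ _); apply: val_inj.
Qed.

(** The Desnanot-Jacobi identity in perturbation form: the two added entries form a product [U *m V]
    of rank at most 2, and the entries of [V *m \adj N *m U] are cofactors scaled by [s] or [t]. *)
Lemma det_add_two_entries (R : idomainType) m (N : 'M[R]_m) (s t : R)
    (r1 c1 r2 c2 : 'I_m) :
  \det N != 0 ->
  \det N * \det (N + s *: delta_mx r1 c1 + t *: delta_mx r2 c2) =
  (\det N + s * cofactor N r1 c1) * (\det N + t * cofactor N r2 c2) -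
  s * t * (cofactor N r1 c2 * cofactor N r2 c1).
Proof.
move=> d0.
pose U : 'M[R]_(m, 2) := \matrix_(i, k)
  if k == 0 then s *+ (i == r1) else t *+ (i == r2).
pose V : 'M[R]_(2, m) := \matrix_(k, j) (j == if k == 0 then c1 else c2)%:R.
have -> : N + s *: delta_mx r1 c1 + t *: delta_mx r2 c2 = N + U *m V.
  apply/matrixP => i j; rewrite !mxE !big_ord_recl big_ord0 !mxE /= addr0.
  rewrite -addrA.
  by congr (_ + (_ + _)); case: eqP; case: eqP; rewrite ?mulr1 ?mulr0 ?mul0r.
pose row_of (l : 'I_2) := if l == 0 then r1 else r2.
pose col_of (k : 'I_2) := if k == 0 then c1 else c2.
have VaU k l : (V *m \adj N *m U) k l =
    (if l == 0 then s else t) * cofactor N (row_of l) (col_of k).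
  have -> : V *m \adj N = \matrix_(k, j) cofactor N j (col_of k).
    apply/matrixP => k' j; rewrite !mxE (bigD1 (col_of k')) //=.
    rewrite big1 => [|j' /negPf nj]; rewrite !mxE ?nj ?mul0r //.
    by rewrite eqxx mul1r addr0.
  rewrite mxE (bigD1 (row_of l)) //= big1 => [|i].
    by rewrite !mxE /row_of; case: (l == 0); rewrite eqxx addr0 mulrC.
  by rewrite !mxE /row_of; case: (l == 0) => /negPf ->; rewrite mulr0.
rewrite det_add_rank2 //; move: (V *m _ *m U) VaU => W VaU.
by rewrite det_mx2 !mxE !VaU /=; ring.
Qed.

(** Each Leibniz product takes one entry per row, so the row degrees [e i] add up; [size] is the
    degree plus one. *)
Lemma size_det_leq (R : idomainType) m (A : 'M[{poly R}]_m) (e : 'I_m -> nat) :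
  (forall i j, (size (A i j) <= (e i).+1)%N) ->
  (size (\det A) <= (\sum_i e i).+1)%N.
Proof.
move=> sA; apply: (leq_trans (size_sum _ _ _)); apply/bigmax_leqP => s _.
rewrite -signr_odd mulr_sign (fun_if (fun p : {poly R} => size p)).
rewrite size_polyN if_same.
apply: (big_ind2 (fun (p : {poly R}) k => size p <= k.+1)%N) => //.
  by rewrite size_poly1.
move=> p k q l sp sq; apply: leq_trans (size_polyMleq _ _) _.
by rewrite -subn1 leq_subLR; have := leq_add sp sq; rewrite addSn addnS.
Qed.

Lemma size_cofactor_leq (R : idomainType) m (A : 'M[{poly R}]_m)
    (e : 'I_m -> nat) i0 j0 :
  (forall i j, (size (A i j) <= (e i).+1)%N) ->
  (size (cofactor A i0 j0) <= (\sum_i e i).+1)%N.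
Proof.
move=> sA; rewrite /cofactor -signr_odd mulr_sign.
rewrite (fun_if (fun p : {poly R} => size p)) size_polyN if_same.
case: m => [|m] in A e i0 j0 sA *; first by case: i0.
apply: leq_trans (size_det_leq (e := fun i => e (lift i0 i)) _) _ => [i j|].
  by rewrite !mxE.
by rewrite ltnS [leqRHS](bigD1_ord i0) //= leq_addl.
Qed.

(** * Substituting polynomials for the variables of a read-once matrix *)

Section Substitution.
Variables (F : fieldType) (n : nat).

(** The values lie in [{poly F}] so that one of the three parameters can stay an indeterminate. *)
Definition pvar_subst (W : 'M[{poly F}]_n) : {mpoly F[n * n]} -> {poly F} :=
  mmap polyC (fun k => mxvec W 0 k).

HB.instance Definition _ W := GRing.RMorphism.on (pvar_subst W).

Lemma pvar_substE W i j : pvar_subst W (pvar F i j) = W i j.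
Proof. by rewrite /pvar_subst /pvar mmapX mmap1U mxvecE. Qed.

Lemma pvar_substC W c : pvar_subst W c%:MP = c%:P.
Proof. exact: mmapC. Qed.

Lemma pvar_subst_permanent W :
  pvar_subst W (permanent F n) = \sum_(s : 'S_n) \prod_i W i (s i).
Proof.
rewrite rmorph_sum; apply: eq_bigr => s _; rewrite rmorph_prod.
by apply: eq_bigr => i _; exact: pvar_substE.
Qed.

Lemma pvar_inj (i j i' j' : 'I_n) :
  pvar F i j = pvar F i' j' -> i = i' /\ j = j'.
Proof.
move=> /(congr1 (pvar_subst (delta_mx i j))).
rewrite !pvar_substE !mxE !eqxx /=.
by case: eqP => [->|_]; case: eqP => [->|_] //= /eqP; rewrite oner_eq0.
Qed.

Lemma pvar_neqC (i j : 'I_n) (c : F) : pvar F i j <> c%:MP.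
Proof.
move=> eq_ij; have e (W : 'M_n) : W i j = c%:P.
  by rewrite -(pvar_substE W) eq_ij pvar_substC.
by have /eqP := e (const_mx 1); rewrite -(e 0) !mxE oner_eq0.
Qed.

Variables (m : nat) (M : 'M[{mpoly F[n * n]}]_m).
Hypothesis roM : read_once M.

(** The read-once hypothesis as it is used below: shifting the value of one variable shifts the
    single entry of [M] that holds it, if there is one. *)
Lemma read_once_subst_delta (i j : 'I_n) :
  (forall W s, map_mx (pvar_subst (W + s *: delta_mx i j)) M =
    map_mx (pvar_subst W) M) \/
  exists r c, forall W s, map_mx (pvar_subst (W + s *: delta_mx i j)) M =
    map_mx (pvar_subst W) M + s *: delta_mx r c.
Proof.
have [varM onceM] := roM.
have ME W s a b : pvar_subst (W + s *: delta_mx i j) (M a b) =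
    pvar_subst W (M a b) + s *+ (M a b == pvar F i j).
  have [[i' [j' ->]]|[c ->]] := varM a b; last first.
    rewrite !pvar_substC; case: eqP => [/esym/pvar_neqC//|_].
    by rewrite addr0.
  rewrite !pvar_substE !mxE.
  case: (pvar F i' j' =P _) => [/pvar_inj[-> ->]|ne_ij].
    by rewrite !eqxx mulr1.
  case: eqP => [e1|_]; last by rewrite mulr0.
  case: eqP => [e2|_]; last by rewrite mulr0.
  by case: ne_ij; rewrite e1 e2.
have [[r c] /eqP Mrc|noM] := pickP (fun ab => M ab.1 ab.2 == pvar F i j).
  right; exists r, c => W s; apply/matrixP => a b; rewrite !mxE ME.
  congr (_ + _); rewrite -mulr_natr; congr (_ * (nat_of_bool _)%:R).
  apply/eqP/andP => [Mab|[/eqP-> /eqP->] //].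
  by have [-> ->] := onceM _ _ _ _ _ _ Mab Mrc.
left => W s; apply/matrixP => a b; rewrite !mxE ME.
by have := noM (a, b) => /= ->; rewrite addr0.
Qed.

Lemma size_map_pvar_subst (W : 'M[{poly F}]_n) (a b : 'I_m) :
  (forall i j, size (W i j) <= 1)%N ->
  (size (map_mx (pvar_subst W) M a b) <= 1)%N.
Proof.
move=> sW; rewrite mxE; have [[i [j ->]]|[c ->]] := roM.1 a b.
  by rewrite pvar_substE.
by rewrite pvar_substC size_polyC leq_b1.
Qed.

End Substitution.

(** * The substituted block matrix *)

Section Block.
Variables (R : comNzRingType) (k : nat).

Definition block_subst (s t x : R) : 'M[R]_(k + 6) :=
  \matrix_(i, j) pad k (fun i j => odflt 0 (bordered_diag s t x i j)) i j.

(** The order of the summands lets [t], then [s], then [x] be peeled off from the right. *)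
Lemma block_substE s t x : block_subst s t x = block_subst 0 0 0
  + x *: delta_mx (rshift k 2%:R) (rshift k 2%:R)
  + s *: delta_mx (rshift k 0) (rshift k 0)
  + t *: delta_mx (rshift k 1) (rshift k 1).
Proof.
apply/matrixP => i j; rewrite !mxE.
case: (split_ordP i) => {}i ->; rewrite ?(eq_lrshift, eq_rlshift) /pad /=.
  by rewrite ltn_ord /= !mulr0 !addr0.
case: (split_ordP j) => {}j ->; rewrite ?(eq_lrshift, eq_rlshift) /=.
  by rewrite orbT /= !andbF !mulr0 !addr0.
rewrite !eq_rshift !ltnNge !leq_addr /= !addKn -!val_eqE /=.
case: i j => -[|[|[|[|[|[|//]]]]]] ? [[|[|[|[|[|[|//]]]]]] ?];
by rewrite /= ?mulr0 ?mulr1 ?addr0 ?add0r.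
Qed.

Lemma permanent_block_subst s t x :
  \sum_(p : 'S_(k + 6)) \prod_i block_subst s t x i (p i) =
  4%:R * (s * t + (s + t) * (x + 1) + x).
Proof.
rewrite -laplace_bordered_diag -perm_sum_laplace -(perm_sum_pad k).
by apply: eq_bigr => p _; apply: eq_bigr => i _; rewrite mxE.
Qed.

End Block.

Lemma block_subst0_size (F : fieldType) k i j :
  (size (block_subst k (0 : {poly F}) 0 0 i j) <= 1)%N.
Proof.
rewrite mxE /pad; case: ifP => _.
  by case: (_ == _); rewrite ?size_poly0 ?size_poly1.
case: (i - k)%N => [|[|[|[|[|[|?]]]]]]; case: (j - k)%N => [|[|[|[|[|[|?]]]]]];
by rewrite /= ?size_poly0 ?size_poly1.
Qed.

(** * Factoring X^2 + X + 1 and the conclusion *)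

Lemma square_of_linear_factors (F : fieldType) (p q : {poly F}) (c : F) :
  c != 0 -> (size p <= 2)%N -> (size q <= 2)%N ->
  p * q = c%:P * ('X ^+ 2 + 'X + 1) -> exists z : F, z ^+ 2 = - 3%:R.
Proof.
move=> c0 sp sq pq.
have e i : (p * q)`_i = c * (('X ^+ 2 + 'X + 1)`_i) by rewrite pq coefCM.
have := e 0%N; have := e 1%N; have := e 2%N.
rewrite !coefM !big_ord_recl !big_ord0 /= !coefD !coefXn !coefX !coef1 /=.
rewrite !addr0 !add0r !mulr1 /bump /= !addn0 !subn0.
rewrite (nth_default _ sp) (nth_default _ sq).
rewrite mul0r mulr0 add0r addr0 => e2 e1 e0.
(* The discriminant of a product of two linear polynomials is the square of their resultant; here it
   equals c^2 - 4 c^2 = -3 c^2. *)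
exists ((p`_0 * q`_1 - p`_1 * q`_0) / c).
apply: (mulfI (expf_neq0 2 c0)).
rewrite -exprMn mulrC divfK //.
have -> : (p`_0 * q`_1 - p`_1 * q`_0) ^+ 2 =
    (p`_0 * q`_1 + p`_1 * q`_0) ^+ 2 - 4%:R * (p`_0 * q`_0) * (p`_1 * q`_1).
  by ring.
by rewrite e0 e1 e2; ring.
Qed.

Lemma permanent_not_read_once (F : fieldType) n :
  quadratic_nonresidue (- 3%:R : F) -> (5 < n)%N ->
  ~ read_once_det (permanent F n).
Proof.
move=> nres n5; rewrite -(subnK n5); set k := (n - 6)%N => {n5}.
move=> [m [M [roM detM]]].
(* If 4 = 0, then -3 = 1 is a square. *)
have four0 : 4%:R != 0 :> F.
  apply/eqP => four0; apply: nres; exists 1.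
  by rewrite expr1n -[LHS]subr0 -four0; ring.
pose N s t x := map_mx (pvar_subst (block_subst k s t x)) M.
have detN s t x : \det (N s t x) = 4%:R * (s * t + (s + t) * (x + 1) + x).
  rewrite det_map_mx detM -(permanent_block_subst k).
  exact: pvar_subst_permanent.
have nz : 4%:R != 0 :> {poly F} by rewrite -polyC_natr polyC_eq0.
pose pos l : 'I_(k + 6) := rshift k l.
(* Each of the three variables does occur in [M]: otherwise raising it from 0 to 1, with the other
   two at 0, would leave the determinant unchanged, whereas it goes from 0 to 4. *)
have occurs l (s t x : {poly F}) : s * t + (s + t) * (x + 1) + x = 1 ->
    block_subst k 0 0 0 + 1 *: delta_mx (pos l) (pos l) = block_subst k s t x ->
    exists r c, forall W y,
      map_mx (pvar_subst (W + y *: delta_mx (pos l) (pos l))) M =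
      map_mx (pvar_subst W) M + y *: delta_mx r c.
  move=> val1 upd; have [noM|//] := read_once_subst_delta roM (pos l) (pos l).
  have /(congr1 determinant) := noM (block_subst k 0 0 0) 1.
  rewrite upd -!/(N _ _ _) !detN val1 => /(mulfI nz)/eqP.
  by rewrite !(mul0r, addr0, add0r) oner_eq0.
have [||r3 [c3 Nx]] := occurs 2%:R 0 0 1; [by ring| |].
  by rewrite [RHS]block_substE !scale0r !addr0.
have [||r1 [c1 Ns]] := occurs 0 1 0 0; [by ring| |].
  by rewrite [RHS]block_substE !scale0r !addr0.
have [||r2 [c2 Nt]] := occurs 1 0 1 0; [by ring| |].
  by rewrite [RHS]block_substE !scale0r !addr0.
have NE s t x : N s t x =
    N 0 0 0 + x *: delta_mx r3 c3 + s *: delta_mx r1 c1 + t *: delta_mx r2 c2.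
  by rewrite {1}/N block_substE Nt Ns Nx.
pose N0 := N 0 0 'X.
have N0E : N0 = N 0 0 0 + 'X *: delta_mx r3 c3.
  by rewrite /N0 NE !scale0r !addr0.
(* The indeterminate sits only at [(r3, c3)], so only row [r3] adds to the degree of a cofactor. *)
have sN0 a b : (size (N0 a b) <= (a == r3).+1)%N.
  have sN := size_map_pvar_subst roM a b (@block_subst0_size F k).
  rewrite N0E mxE (leq_trans (size_polyD _ _)) // geq_max (leq_trans sN) //=.
  rewrite !mxE; case: (a == r3); case: (b == c3);
  by rewrite ?mulr1 ?mulr0 ?size_poly0 ?size_polyX.
have sum1 : (\sum_a (a == r3) = 1)%N by rewrite -big_mkcond big_pred1_eq.
have scof r c : (size (cofactor N0 r c) <= 2)%N.
  by have := size_cofactor_leq r c sN0; rewrite sum1.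
have dN0 : \det N0 = 4%:R * 'X by rewrite detN !(mul0r, add0r).
have d0 : \det N0 != 0 by rewrite dN0 mulf_neq0 ?polyX_eq0.
have detNst s t : \det N0 * \det (N s t 'X) =
    (\det N0 + s * cofactor N0 r1 c1) * (\det N0 + t * cofactor N0 r2 c2) -
    s * t * (cofactor N0 r1 c2 * cofactor N0 r2 c1).
  by rewrite NE -N0E det_add_two_entries.
(* Taking one of [s], [t] to be 1 and the other 0 removes the mixed term and expresses the diagonal
   factors as known determinants. *)
have c1E : \det N0 + cofactor N0 r1 c1 = \det (N 1 0 'X).
  by apply: (mulfI d0); rewrite detNst; ring.
have c2E : \det N0 + cofactor N0 r2 c2 = \det (N 0 1 'X).
  by apply: (mulfI d0); rewrite detNst; ring.
apply: nres.
apply: (square_of_linear_factors (c := 4%:R * 4%:R) _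
  (scof r1 c2) (scof r2 c1)).
  by rewrite mulf_neq0.
(* At [s = t = 1] the mixed cofactors multiply to 16 ((2 X + 1)^2 - X (3 X + 3)) = 16 (X^2 + X +
   1). *)
have := detNst 1 1; rewrite !mul1r c1E c2E => /eqP.
rewrite eq_sym subr_eq => /eqP e.
have -> : cofactor N0 r1 c2 * cofactor N0 r2 c1 =
   \det (N 1 0 'X) * \det (N 0 1 'X) - \det N0 * \det (N 1 1 'X).
  by rewrite e; ring.
by rewrite dN0 !detN polyCM polyC_natr; ring.
Qed.

Lemma nonresidue_m3_real (R : realType) : quadratic_nonresidue (- 3%:R : R).
Proof.
by move=> [x x2]; have := sqr_ge0 x; rewrite x2 oppr_ge0 lern0.
Qed.

Theorem theorem2 :
  (forall (R : realType) (n : nat), (5 < n)%N -> ~ read_once_det (permanent R n)) /\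
  (forall F : finFieldType, quadratic_nonresidue (- 3%:R : F) ->
    forall n : nat, (5 < n)%N -> ~ read_once_det (permanent F n)).
Proof.
split=> [R n|F nres n]; apply: permanent_not_read_once => //.
exact: nonresidue_m3_real.
Qed.
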